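(* Fix $\alpha<1$, a constant $c\ge 1$, and functions $p_-,p_+$ of the positive integer $r$ with $p_-(r)=\Omega(1/r)$ and $p_+(r)=O(1/r)$. There exist constants $\beta,c_1,c_2>0$ depending only on $\alpha,c,p_-,p_+$ such that the following holds. Let $n'$ and $m\ge2$ be positive integers with $n'/m>\beta$. Let $f:\{1,\dots,n'\}\cup\{\varnothing\}\to\mathbb{R}$ satisfy $f(\varnothing)=0$, $f(k)>0$ for $k\in[n']$, $\max_{i\in[n']}f(i)\le c\min_{i\in[n']}f(i)$, and, for every $S\subseteq[n']$ with $|S|=r$ and every $a\in S$, $$p_-(r)\le\frac{f(a)}{\sum_{k\in S}f(k)}\le p_+(r).$$ Consider a game of $f$-war with $n'$ cards and $m$ players such that the starting vector $\mathbf{x}$ of hand sizes satisfies $x_i\le\alpha n'$ for all $i$. Then the expected length $L$ of the game (expected number of turns until one player holds all $n'$ cards) satisfies $c_1 n'^2\le L\le c_2 n'^2$, i.e. it is $\Theta(n'^2)$.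
   Context: Write $[m]=\{1,\dots,m\}$, $[n']=\{1,\dots,n'\}$. $m$-player $f$-war with $n'$ cards is the Markov chain whose states are tuples $(A_i)_{i\in[m]}$ of disjoint ordered tuples of elements of $[n']$ with $\bigsqcup_{i=1}^m A_i=[n']$ (the ordered hands). The initial hands are obtained by choosing a vector $\mathbf{x}=(x_1,\dots,x_m)$ of nonnegative integers with sum $n'$, randomly shuffling the deck $[n']$ and partitioning the cards so that $|A_i(0)|=x_i$. The absorbing states are those with $|A_i|=n'$ for some $i$. At each turn, player $i$ plays the card $a_i$ at the start of $A_i(t)$ ($a_i=\varnothing$ if the hand is empty). With probability $f(a_i)/\sum_{j=1}^m f(a_j)$ player $i$ wins all played cards, which are added to the end of $A_i(t)\setminus\{a_i\}$ in arbitrary order, while every other player loses the card they played. *)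

(* Defs.v *)
From HB Require Import structures.
From mathcomp Require Import all_boot all_order all_algebra all_fingroup.
From mathcomp Require Import all_classical all_reals all_analysis.

Set Implicit Arguments.
Unset Strict Implicit.
Unset Printing Implicit Defensive.

Import Order.TTheory GRing.Theory Num.Theory.
Import numFieldNormedType.Exports.

Local Open Scope classical_set_scope.
Local Open Scope ring_scope.

(* One-sided, unlike the =Omega_ of mathcomp-analysis, which bounds `|p r| and
   would therefore accept p r = - 1/r as a lower bound.  *)
Definition Omega_inv {R : realType} (p : nat -> R) : Prop :=
  exists2 k : R, 0 < k & \forall r \near \oo, k / r%:R <= p r.

Section War.
Variables n m : nat.

(* The deck is 'I_n; in a hand the next card to be played comes first. *)
Definition hands := {ffun 'I_m -> seq 'I_n}.

(* The hands are duplicate-free, pairwise disjoint, and cover the deck. *)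
Definition is_state (A : hands) : Prop :=
  perm_eq (flatten [seq A i | i <- enum 'I_m]) (enum 'I_n).

Definition absorbing (A : hands) : Prop := exists i, size (A i) = n.

(* None is the "empty card" played from an empty hand. *)
Definition top_card (A : hands) (i : 'I_m) : option 'I_n := ohead (A i).

Definition played (A : hands) : seq 'I_n := pmap (top_card A) (enum 'I_m).

(* B may follow A on a turn won by i: the permutation s of the played cards is
   the order in which i picks them up, which is left unconstrained. *)
Definition turn (A : hands) (i : 'I_m) (B : hands) : Prop :=
  (forall j, j != i -> B j = behead (A j)) /\
  (exists2 s, perm_eq s (played A) & B i = behead (A i) ++ s).

(* The shuffled deck s 0, s 1, ... cut into consecutive hands of sizes x i. *)
Definition deal (x : 'I_m -> nat) (s : 'S_n) : hands :=
  [ffun i : 'I_m => nth [::]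
     (reshape [seq x j | j <- enum 'I_m] [seq s k | k <- enum 'I_n]) i].

Definition win_prob {R : realType} (f : option 'I_n -> R) (A : hands)
    (i : 'I_m) : R :=
  f (top_card A i) / \sum_(j < m) f (top_card A j).

Section Game.
Context {R : realType} {d : measure_display} {Omega : measurableType d}.
Variable P : probability Omega R.

Definition history (A : nat -> Omega -> hands) (t : nat) (h : nat -> hands) :
    set Omega :=
  [set w | forall k, (k <= t)%N -> A k w = h k].

(* A t w is the state after t turns.  The winner of a turn has the prescribed
   law conditionally on the whole past.  Nothing is required of the order in
   which the won cards are picked up: it may follow any rule, deterministic or
   random, depending on the state alone (A is then a Markov chain) or on the
   past.  A winner with at least two cards on the table is determined by the
   states before and after the turn, so the events in [game_step] are disjoint
   for distinct i, and almost surely one of them occurs. *)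
Record f_war (f : option 'I_n -> R) (x : 'I_m -> nat)
    (A : nat -> Omega -> hands) : Prop := {
  game_measurable : forall t s, measurable [set w | A t w = s];
  game_state : forall t w, is_state (A t w);
  game_start : forall s : 'S_n,
    P [set w | A 0%N w = deal x s] = ((n`!)%:R^-1)%:E;
  game_step : forall t (h : nat -> hands) (i : 'I_m), ~ absorbing (h t) ->
    P (history A t h `&` [set w | turn (A t w) i (A t.+1 w)])
    = (P (history A t h) * (win_prob f (h t) i)%:E)%E;
  game_absorbed : forall t w, absorbing (A t w) -> A t.+1 w = A t w
}.

(* +oo if the game never ends. *)
Definition game_length (A : nat -> Omega -> hands) (w : Omega) : \bar R :=
  ereal_inf [set (t%:R)%:E | t in [set t | absorbing (A t w)]].

Definition expected_length (A : nat -> Omega -> hands) : \bar R :=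
  (\int[P]_w game_length A w)%E.

End Game.
End War.

(* Main.v *)
Require Import Defs.
From mathcomp Require Import all_boot all_order all_algebra.
From mathcomp Require Import perm.
From mathcomp Require Import all_classical all_reals all_analysis.
From mathcomp Require Import measurable_realfun.
From mathcomp Require Import ring lra.

Set Implicit Arguments.
Unset Strict Implicit.
Unset Printing Implicit Defensive.

Import Order.TTheory GRing.Theory Num.Theory.
Import numFieldNormedType.Exports.

Local Open Scope classical_set_scope.
Local Open Scope ring_scope.

(** The weight of a hand is the sum of [f] over its cards.  A player who plays a
    card of value [a] while the played cards have total value [F] loses [a] for
    sure and gains [F] with probability [a / F]; hence every weight is a
    martingale, with variance [a * (F - a)] per turn, and a sum of [phi] of the
    weights drifts by the second-order part of [phi] only ([hand_drift]).  After
    dividing [f] by its minimum one may assume [1 <= f <= C].  Write [r] for the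
    number of nonempty hands, [T] for the total weight, which is between [n] and
    [C * n], and [p t] for the probability that the game is still going on after
    [t] turns, so that the expected length is the series of the [p t]
    ([expected_length_series]).

    Upper bound.  The sum of the squared weights drifts by at least
    [r * (r - 1) >= 2] per turn and never exceeds [T ^+ 2]
    ([sum_alive_le_sqr]).

    Lower bound.  As no hand is too big at the start, the sum of the squared
    weights has to grow by a multiple of [n ^+ 2].  With many players it grows
    quickly, by about [r ^+ 2] per turn, so one has to see that the turns with
    many players account for a small part of this growth.  Let [h] be a small
    multiple of [n] and let [huber h] be quadratic up to [h] and linear beyond.
    If [r] is larger than a constant [K], at least half of the players have
    weight at most [h / 2], so the sum of the [huber h] of the weights also
    drifts by a multiple of [r ^+ 2] ([drift_huber_ge]); but this sum is at most
    [h * T], a small multiple of [n ^+ 2].  Therefore the sum of the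
    [y ^+ 2 - 8 * C ^+ 2 * huber h y] over the weights [y] still has to grow by
    a multiple of [n ^+ 2], and drifts by at most the constant [(C * K) ^+ 2]
    per turn ([drift_mixed_le]).  The hypothesis that [n / m] is large ensures
    that the pot, which is at most [C * m], is small compared to [h].  The
    comparison is made at a fixed time [N] such that [p N] is small, which the
    upper bound provides ([exists_alive_small]).

    The passage from the process to drifts rests on [at_wins]: summing the step
    axiom over all histories that lead to a state gives the law of the winner
    conditionally on that state alone. *)

(** * Drift of a function of one weight *)

Section HandDrift.
Variable R : realFieldType.
Implicit Types (phi psi : R -> R) (x y a F h B : R).

(** Expected change of [phi] at the weight [x] of a player who puts [a] into a
    pot of value [F], which he wins with probability [a / F]. *)
Definition hand_drift phi x a F : R :=
  a / F * phi (x - a + F) + (1 - a / F) * phi (x - a) - phi x.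

Lemma hand_drift_sqr x a F : F != 0 ->
  hand_drift (fun y => y ^+ 2) x a F = a * (F - a).
Proof. by move=> F0; rewrite /hand_drift; field. Qed.

Lemma hand_drift_sub phi psi B x a F :
  hand_drift (fun y => phi y - B * psi y) x a F =
  hand_drift phi x a F - B * hand_drift psi x a F.
Proof. by rewrite /hand_drift; ring. Qed.

Lemma hand_drift0 phi x F : hand_drift phi x 0 F = 0.
Proof. by rewrite /hand_drift mul0r !subr0 mul0r add0r mul1r subrr. Qed.

Definition huber h x : R := if x <= h then x ^+ 2 / 2 else h * x - h ^+ 2 / 2.

Lemma huber_ge0 h x : 0 <= h -> 0 <= huber h x.
Proof.
move=> h0; rewrite /huber; case: (leP x h) => xh /=.
  by rewrite divr_ge0 ?sqr_ge0.
have := ler_wpM2l h0 (ltW xh); have := sqr_ge0 h; lra.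
Qed.

Lemma huber_le h x : 0 <= x -> huber h x <= h * x.
Proof.
move=> x0; rewrite /huber; case: (leP x h) => xh /=.
  have := ler_wpM2r x0 xh; have := sqr_ge0 x; lra.
have := sqr_ge0 h; lra.
Qed.

(** The function [huber h] is convex, with derivative [min x h] at [x]. *)
Lemma huber_tangent h x y :
  huber h x + Num.min x h * (y - x) <= huber h y.
Proof.
rewrite /huber; case: (leP x h) => xh /=; case: (leP y h) => yh /=.
- have := sqr_ge0 (y - x); lra.
- have h1 : 0 <= h - x by rewrite subr_ge0.
  have := mulr_ge0 h1 (ltW (_ : 0 < y - h)); rewrite subr_gt0 => /(_ yh).
  have := sqr_ge0 (h - x); lra.
- have := sqr_ge0 (h - y); lra.
- lra.
Qed.

(** Jensen's inequality: the weight is a martingale and [huber h] is convex. *)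
Lemma hand_drift_huber_ge0 h x a F : 0 <= a <= F -> 0 < F ->
  0 <= hand_drift (huber h) x a F.
Proof.
move=> /andP[a0 aF] F0; rewrite /hand_drift.
have q0 : 0 <= a / F by rewrite divr_ge0 // ltW.
have q1 : a / F <= 1 by rewrite ler_pdivrMr // mul1r.
have h1 := huber_tangent h x (x - a + F).
have h2 := huber_tangent h x (x - a).
have h3 := ler_wpM2l q0 h1.
have q1' : 0 <= 1 - a / F by rewrite subr_ge0.
have h4 := ler_wpM2l q1' h2.
have E : a / F * (x - a + F - x) + (1 - a / F) * (x - a - x) = 0.
  by field; rewrite gt_eqF.
move: E h3 h4; set q := a / F; set mn := Num.min x h => E h3 h4.
(* the tangent terms cancel because the change of weight has mean 0 *)
have : mn * (q * (x - a + F - x) + (1 - q) * (x - a - x)) = 0.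
  by rewrite E mulr0.
lra.
Qed.

(** A weight that cannot exceed [h] this turn only sees the quadratic part. *)
Lemma hand_drift_huber_quad h x a F : 0 <= a <= F -> 0 < F -> x + F <= h ->
  hand_drift (huber h) x a F = a * (F - a) / 2.
Proof.
move=> /andP[a0 aF] F0 xFh; rewrite /hand_drift /huber.
have -> : x - a + F <= h by lra.
have -> : x - a <= h by lra.
have -> : x <= h by lra.
by field; rewrite gt_eqF.
Qed.

End HandDrift.

(** * Potentials and turns of the game *)

Section Turns.
Variables (R : realType) (n m : nat) (f : option 'I_n -> R).
Implicit Types (A B : hands n m) (i j : 'I_m) (s : seq 'I_n) (phi : R -> R).

Definition pot A : R := \sum_(j < m) f (top_card A j).

Definition hand_weight A i : R := \sum_(a <- A i) f (Some a).

Definition potential phi A : R := \sum_(j < m) phi (hand_weight A j).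

Definition potential_after phi A i : R :=
  \sum_(j < m) phi (hand_weight A j - f (top_card A j) + (j == i)%:R * pot A).

Hypothesis fN : f None = 0.

Lemma sum_behead s :
  \sum_(a <- behead s) f (Some a) = \sum_(a <- s) f (Some a) - f (ohead s).
Proof.
case: s => [|a s] /=; rewrite ?big_nil ?fN ?subrr //.
by rewrite big_cons addrAC subrr add0r.
Qed.

Lemma sum_played A : \sum_(a <- played A) f (Some a) = pot A.
Proof.
rewrite /pot /played big_pmap big_enum /=.
by apply: eq_bigr => i _; case: (top_card A i).
Qed.

Lemma hand_weight_turn A i B j : turn A i B ->
  hand_weight B j = hand_weight A j - f (top_card A j) + (j == i)%:R * pot A.
Proof.
move=> [lose [s sP win]]; rewrite /hand_weight.
have [->|ji] := eqVneq j i.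
  by rewrite win big_cat /= sum_behead (perm_big _ sP) sum_played mul1r.
by rewrite lose // sum_behead mul0r addr0.
Qed.

Lemma potential_turn phi A i B : turn A i B ->
  potential phi B = potential_after phi A i.
Proof. by move=> AB; apply: eq_bigr => j _; rewrite (hand_weight_turn j AB). Qed.

Lemma sum_win_prob A : pot A != 0 -> \sum_(i < m) win_prob f A i = 1.
Proof. by move=> F0; rewrite -mulr_suml divff. Qed.

(** The players are coupled through the winner, but [phi] of one weight only
    depends on whether its owner wins, so the expectation splits into one
    [hand_drift] per player. *)
Lemma expected_potential phi A : pot A != 0 ->
  \sum_(i < m) win_prob f A i * potential_after phi A i =
  potential phi A +
  \sum_(j < m) hand_drift phi (hand_weight A j) (f (top_card A j)) (pot A).
Proof.
move=> F0; under eq_bigr do rewrite mulr_sumr.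
rewrite exchange_big /= -big_split /=; apply: eq_bigr => j _.
rewrite (bigD1 j) //= eqxx mul1r.
under eq_bigr => i ij do rewrite eq_sym (negPf ij) mul0r addr0.
rewrite -mulr_suml.
have -> : \sum_(i < m | i != j) win_prob f A i = 1 - win_prob f A j.
  by rewrite -(sum_win_prob F0) [in RHS](bigD1 j) //= addrAC subrr add0r.
by rewrite /hand_drift /win_prob -/(pot A); ring.
Qed.

End Turns.

(** * Weights in a state of the game *)

Section States.
Variables (n m : nat) (A : hands n m).
Hypothesis stA : is_state A.

Lemma sum_state (V : nmodType) (g : 'I_n -> V) :
  \sum_(i < m) \sum_(a <- A i) g a = \sum_(k < n) g k.
Proof.
rewrite -(big_enum _ _ _ g) /= -(perm_big _ stA) big_flatten big_map /=.
by rewrite big_enum.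
Qed.

Lemma sum_size_state : (\sum_(i < m) size (A i))%N = n.
Proof.
under eq_bigr do rewrite -sum1_size.
by rewrite (sum_state (fun=> 1%N)) sum1_card card_ord.
Qed.

Lemma absorbing_empty i j : size (A i) = n -> j != i -> A j = [::].
Proof.
move=> Ain ji; apply/nilP; rewrite /nilp -leqn0.
rewrite -(leq_add2l n) addn0 -{1}Ain -[leqRHS]sum_size_state (bigD1 i) //=.
by rewrite leq_add2l (bigD1 j) //= leq_addr.
Qed.

Definition active_count (R : realType) : R := \sum_(j < m) (A j != [::])%:R.

Lemma active_count_le (R : realType) : active_count R <= m%:R.
Proof.
rewrite -[m in leRHS]card_ord -sum1_card natr_sum.
by apply: ler_sum => j _; case: (_ != _).
Qed.

Lemma active_count_ge2 (R : realType) : (0 < m)%N -> ~ absorbing A ->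
  2 <= active_count R.
Proof.
move=> m0 nabs.
have two i : exists2 j, j != i & A j != [::].
  apply: contrapT => none; apply: nabs; exists i.
  rewrite -[RHS]sum_size_state (bigD1 i) //= big1 ?addn0 // => j ji.
  apply/eqP; rewrite size_eq0; apply: contraPT isT => Aj.
  by case: none; exists j.
pose i0 : 'I_m := Ordinal m0.
have [i ii0 Ai] := two i0; have [j ji Aj] := two i.
rewrite /active_count (bigD1 i) //= (bigD1 j) //= Ai Aj addrA lerDl.
by rewrite sumr_ge0.
Qed.
End States.

Section Estimates.
Variables (R : realType) (n m : nat) (f : option 'I_n -> R) (C : R).
Hypothesis fN : f None = 0.
Hypothesis f_ge1 : forall k, 1 <= f (Some k).
Hypothesis f_leC : forall k, f (Some k) <= C.
Variable A : hands n m.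
Hypothesis stA : is_state A.
Local Notation r := (active_count A R).
Local Notation F := (pot f A).
Local Notation M := (hand_weight f A).
Local Notation a j := (f (top_card A j)).

Lemma top_ge j : (A j != [::])%:R <= a j.
Proof. by rewrite /top_card; case: (A j) => [|b s] /=; rewrite ?fN. Qed.

Lemma top_le j : a j <= C * (A j != [::])%:R.
Proof.
by rewrite /top_card; case: (A j) => [|b s] /=; rewrite ?fN ?mulr0 ?mulr1.
Qed.

Lemma top_ge0 j : 0 <= a j.
Proof. exact: le_trans (top_ge j). Qed.

Lemma pot_ge : r <= F.
Proof. by apply: ler_sum => j _; exact: top_ge. Qed.

Lemma pot_le : F <= C * r.
Proof. by rewrite mulr_sumr; apply: ler_sum => j _; exact: top_le. Qed.

Lemma top_le_pot j : a j <= F.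
Proof.
by rewrite /pot (bigD1 j) //= lerDl sumr_ge0 // => i _; exact: top_ge0.
Qed.

Lemma others_ge j : r - 1 <= F - a j.
Proof.
rewrite /pot (bigD1 j) //= addrAC subrr add0r /active_count (bigD1 j) //=.
rewrite addrAC -[leRHS]add0r lerD //; first by rewrite subr_le0; case: (_ != _).
by apply: ler_sum => i _; exact: top_ge.
Qed.

Lemma size_le_weight j : (size (A j))%:R <= M j.
Proof.
rewrite -sum1_size natr_sum; apply: ler_sum => b _; exact: f_ge1.
Qed.

Lemma weight_ge0 j : 0 <= M j.
Proof. exact: le_trans (size_le_weight j). Qed.

Definition total : R := \sum_(k < n) f (Some k).

Lemma sum_weight : \sum_(j < m) M j = total.
Proof. exact: sum_state. Qed.

Lemma total_ge : n%:R <= total.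
Proof.
rewrite -[n in leLHS]card_ord -sum1_card natr_sum; apply: ler_sum => k _.
exact: f_ge1.
Qed.

Lemma total_le : total <= C * n%:R.
Proof.
rewrite -[n in leRHS]card_ord -sum1_card natr_sum mulr_sumr.
by apply: ler_sum => k _; rewrite mulr1.
Qed.

Lemma total_ge0 : 0 <= total.
Proof. exact: le_trans total_ge. Qed.

Lemma sum_sqr_weight_le : \sum_(j < m) M j ^+ 2 <= total ^+ 2.
Proof.
rewrite expr2 -{1}sum_weight mulr_suml; apply: ler_sum => j _.
rewrite expr2 ler_wpM2l ?weight_ge0 // -sum_weight (bigD1 j) //= lerDl.
by rewrite sumr_ge0 // => i _; exact: weight_ge0.
Qed.

Lemma sum_sqr_weight_absorbing : absorbing A ->
  \sum_(j < m) M j ^+ 2 = total ^+ 2.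
Proof.
move=> [i Ain]; rewrite -sum_weight.
have M0 j : j != i -> M j = 0.
  by move=> ji; rewrite /hand_weight (absorbing_empty stA Ain ji) big_nil.
rewrite (bigD1 i) //= big1 ?addr0; last by move=> j /M0 ->; rewrite expr0n.
by rewrite (bigD1 i) //= [in RHS]big1 ?addr0.
Qed.

(** The sum of [M j * (total - M j)] is at least that of [x j * (n - x j)], where
    [x j] are the sizes of the hands, and [n - x j >= (1 - alpha) * n].  The
    bound holds for each dealing of the cards, not only on average. *)
Lemma sum_sqr_weight_balanced alpha :
  (forall j, (size (A j))%:R <= alpha * n%:R) ->
  \sum_(j < m) M j ^+ 2 <= total ^+ 2 - (1 - alpha) * n%:R ^+ 2.
Proof.
move=> bal.
suff : (1 - alpha) * n%:R ^+ 2 <= total ^+ 2 - \sum_(j < m) M j ^+ 2 by lra.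
rewrite [total ^+ 2]expr2 -{1}sum_weight mulr_suml -sumrB.
have -> : (1 - alpha) * n%:R ^+ 2 =
    \sum_(j < m) (size (A j))%:R * ((1 - alpha) * n%:R) :> R.
  by rewrite -mulr_suml -natr_sum sum_size_state // expr2; ring.
apply: ler_sum => j _; rewrite expr2 -mulrBr.
have s_le : (size (A j))%:R <= M j := size_le_weight j.
have o_ge : (1 - alpha) * n%:R <= total - M j.
  rewrite -sum_weight (bigD1 j) //= addrAC subrr add0r.
  have : \sum_(i < m | i != j) (size (A i))%:R <= \sum_(i < m | i != j) M i.
    by apply: ler_sum => i _; exact: size_le_weight.
  apply: le_trans; have := bal j.
  have : n%:R = (size (A j))%:R + \sum_(i < m | i != j) (size (A i))%:R :> R.
    by rewrite -[in LHS](sum_size_state stA) natr_sum (bigD1 j).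
  lra.
have [nneg|neg] := leP 0 ((1 - alpha) * n%:R); first exact: ler_pM.
apply: (@le_trans _ _ 0); first by rewrite mulr_ge0_le0 // ltW.
rewrite mulr_ge0 ?weight_ge0 // subr_ge0 -sum_weight (bigD1 j) //= lerDl.
by rewrite sumr_ge0 // => i _; exact: weight_ge0.
Qed.

Definition drift phi := \sum_(j < m) hand_drift phi (M j) (a j) F.

Lemma drift_sub phi psi B :
  drift (fun y => phi y - B * psi y) = drift phi - B * drift psi.
Proof.
by rewrite /drift mulr_sumr -sumrB; apply: eq_bigr => j _; exact: hand_drift_sub.
Qed.

Hypothesis m0 : (0 < m)%N.
Hypothesis nabs : ~ absorbing A.

Lemma count_ge2 : 2 <= r.
Proof. exact: active_count_ge2. Qed.

Lemma pot_gt0 : 0 < F.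
Proof. by apply: lt_le_trans pot_ge; apply: lt_le_trans count_ge2. Qed.

Lemma pot_neq0 : F != 0.
Proof. by rewrite gt_eqF // pot_gt0. Qed.

Lemma drift_sqr_ge : 2 <= drift (fun y => y ^+ 2).
Proof.
have r2 := count_ge2; apply: (@le_trans _ _ (r * (r - 1))).
  have := mulr_ge0 (_ : 0 <= r - 2) (_ : 0 <= r); nra.
rewrite mulr_suml; apply: ler_sum => j _; rewrite hand_drift_sqr ?pot_neq0 //.
apply: ler_pM => //; [lra|exact: top_ge|exact: others_ge].
Qed.

Lemma drift_sqr_le : 1 <= C -> drift (fun y => y ^+ 2) <= (C * r) ^+ 2.
Proof.
move=> C1; apply: (@le_trans _ _ (F ^+ 2)); last first.
  rewrite ler_pXn2r ?nnegrE ?pot_le ?(ltW pot_gt0) //.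
  by rewrite mulr_ge0 ?(le_trans _ count_ge2) ?(le_trans _ C1).
rewrite expr2 {1}/pot mulr_suml; apply: ler_sum => j _.
rewrite hand_drift_sqr ?pot_neq0 // ler_wpM2l ?top_ge0 //.
by rewrite gerBl top_ge0.
Qed.

(** The factor [1 - M j / (h - F)] is at most 1, and it is negative for the
    players too heavy to stay below [h]: it replaces counting the light players
    by an inequality that is linear in the weights and can be summed. *)
Lemma hand_drift_huber_active h j : 0 < h - F ->
  (A j != [::])%:R * ((r - 1) / 2 * (1 - M j / (h - F))) <=
  hand_drift (huber h) (M j) (a j) F.
Proof.
move=> hF; have hF0 := ltW hF; have r2 := count_ge2.
have [Aj|Aj] := eqVneq (A j) [::].
  by rewrite /= mul0r /top_card Aj /= fN hand_drift0.
rewrite /= mul1r.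
have aF : 0 <= a j <= F by rewrite top_ge0 top_le_pot.
have M0 := weight_ge0 j.
have [Mh|Mh] := leP (M j + F) h.
  rewrite (hand_drift_huber_quad aF pot_gt0 Mh).
  have : M j / (h - F) >= 0 by rewrite divr_ge0.
  have : 1 <= a j by have := top_ge j; rewrite Aj.
  have := others_ge j.
  set z := M j / _; move=> o1 a1 z0.
  have := ler_pM (_ : 0 <= 1) (_ : 0 <= r - 1) a1 o1.
  have : 0 <= (r - 1) * z by rewrite mulr_ge0 //; lra.
  rewrite ler01 => + /(_ isT).
  rewrite subr_ge0 (le_trans _ r2) ?ler1n // => + /(_ isT).
  lra.
apply: le_trans (hand_drift_huber_ge0 _ _ aF pot_gt0).
rewrite pmulr_rle0; last lra.
by rewrite subr_le0 ler_pdivlMr // mul1r; lra.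
Qed.

Lemma drift_huber_ge0 h : 0 <= drift (huber h).
Proof.
apply: sumr_ge0 => j _; apply: hand_drift_huber_ge0; last exact: pot_gt0.
by rewrite top_ge0 top_le_pot.
Qed.

(** The condition says that [h - F] is at least twice the average weight of the
    remaining players, so that at least half of them are below [h - F]; each of
    these contributes at least [(r - 1) / 2]. *)
Lemma drift_huber_ge h : 0 < h - F -> 2 * total <= r * (h - F) ->
  r ^+ 2 / 8 <= drift (huber h).
Proof.
move=> hF Tr; have r2 := count_ge2.
apply: le_trans (ler_sum _ (fun j _ => hand_drift_huber_active j hF)).
have lin j : (r - 1) / 2 * ((A j != [::])%:R - M j / (h - F)) <=
   (A j != [::])%:R * ((r - 1) / 2 * (1 - M j / (h - F))).
  have [|] := boolP (A j != [::]) => _; first by rewrite mul1r.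
  rewrite mul0r sub0r mulrN oppr_le0 mulr_ge0 ?divr_ge0 ?weight_ge0 ?(ltW hF) //.
  lra.
apply: le_trans (ler_sum _ (fun j _ => lin j)).
rewrite -mulr_sumr sumrB -mulr_suml sum_weight -/r.
have : total / (h - F) <= r / 2 by rewrite ler_pdivrMr //; lra.
set z := total / _ => z_le.
have := mulr_ge0 (_ : 0 <= r - 1) (_ : 0 <= r / 2 - z); rewrite !subr_ge0 z_le.
rewrite (le_trans _ r2) ?ler1n // => /(_ isT isT) h1.
have := mulr_ge0 (_ : 0 <= r) (_ : 0 <= r - 2); rewrite !subr_ge0 r2.
rewrite (le_trans _ r2) // => /(_ isT isT) h2.
lra.
Qed.

(** With more than [K] players the coefficient [8 * C ^+ 2] makes the lower bound
    [r ^+ 2 / 8] on the drift of [huber h] absorb the upper bound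
    [(C * r) ^+ 2] on that of the square; with at most [K] players the latter is
    itself bounded. *)
Lemma drift_mixed_le h K : 1 <= C -> C * m%:R <= h / 2 -> 0 < h ->
  4 * total <= K * h ->
  drift (fun y => y ^+ 2 - (8 * C ^+ 2) * huber h y) <= (C * K) ^+ 2.
Proof.
move=> C1 mh h0 TK; rewrite drift_sub; have r2 := count_ge2.
have up := drift_sqr_le C1.
have F_le : F <= h / 2.
  apply: le_trans mh; apply: le_trans pot_le _.
  by rewrite ler_wpM2l ?active_count_le // (le_trans _ C1).
have [rK|Kr] := leP r K.
  have : 0 <= 8 * C ^+ 2 * drift (huber h).
    by rewrite mulr_ge0 ?drift_huber_ge0 // mulr_ge0 ?sqr_ge0.
  have : (C * r) ^+ 2 <= (C * K) ^+ 2.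
    rewrite ler_pXn2r ?nnegrE ?mulr_ge0 ?ler_wpM2l //; lra.
  lra.
have K0 : 0 <= K.
  have := total_ge0; rewrite -(pmulr_lge0 _ h0); lra.
have lower : r ^+ 2 / 8 <= drift (huber h).
  apply: drift_huber_ge; first lra.
  have : K * h <= r * h by rewrite ler_wpM2r // ltW.
  have : r * (h / 2) <= r * (h - F) by rewrite ler_wpM2l //; lra.
  lra.
have := ler_wpM2l (_ : 0 <= 8 * C ^+ 2) lower; rewrite mulr_ge0 ?sqr_ge0 //.
move=> /(_ isT) low; have := sqr_ge0 (C * K); rewrite !exprMn in up *; lra.
Qed.

End Estimates.

(** * Dealing the deck *)

Section Deal.
Variables (n m : nat) (x : 'I_m -> nat).
Hypothesis x_sum : (\sum_(i < m) x i)%N = n.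

Lemma sumn_deal_sizes : sumn [seq x j | j <- enum 'I_m] = n.
Proof. by rewrite sumnE big_map big_enum. Qed.

Lemma size_deal (s : 'S_n) i : size (deal x s i) = x i.
Proof.
rewrite ffunE -nth_shape reshapeKl; last first.
  by rewrite sumn_deal_sizes size_map size_enum_ord.
by rewrite (nth_map i) ?size_enum_ord // nth_ord_enum.
Qed.

Lemma deal_inj : injective (@deal n m x).
Proof.
move=> s t st.
suff /eq_in_map eq_st : [seq s k | k <- enum 'I_n] = [seq t k | k <- enum 'I_n].
  by apply/permP => k; apply: eq_st; rewrite mem_enum.
set sh := [seq x j | j <- enum 'I_m].
have flatK (u : 'S_n) : flatten (reshape sh [seq u k | k <- enum 'I_n]) =
    [seq u k | k <- enum 'I_n].
  by rewrite reshapeKr // size_map size_enum_ord sumn_deal_sizes.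
rewrite -(flatK s) -(flatK t); congr flatten.
have sz (u : 'S_n) : size (reshape sh [seq u k | k <- enum 'I_n]) = m.
  by rewrite size_reshape size_map size_enum_ord.
apply: (@eq_from_nth _ [::]) => [|i]; rewrite !sz // => im.
by have := congr1 (fun A : hands n m => A (Ordinal im)) st; rewrite !ffunE.
Qed.

End Deal.

(** * The states form a finite list *)

Section StateList.
Variables n m : nat.

(** Hands of at most [n] cards are bounded sequences, which form a finite type. *)
Definition states : seq (hands n m) :=
  [seq A : hands n m <- undup 
      [seq ([ffun i => val (g i)] : hands n m)
      | g : {ffun 'I_m -> n.-bseq 'I_n} <- enum {: {ffun 'I_m -> n.-bseq 'I_n}}]
  | perm_eq (flatten [seq A i | i <- enum 'I_m]) (enum 'I_n)].

Lemma states_uniq : uniq states.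
Proof. by rewrite filter_uniq ?undup_uniq. Qed.

Lemma mem_states A : is_state A <-> A \in states.
Proof.
rewrite mem_filter mem_undup; split => [stA|/andP[] //].
rewrite [X in X && _]stA /=.
have szA i : (size (A i) <= n)%N.
  by rewrite -[leqRHS](sum_size_state stA) (bigD1 i) //= leq_addr.
apply/mapP; exists [ffun i => Bseq (szA i)]; first by rewrite mem_enum.
by apply/ffunP => i; rewrite !ffunE.
Qed.

End StateList.

(** * Random variables with finitely many values *)

Section FiniteValued.
Context {R : realType} {d : measure_display} {Omega : measurableType d}.
Variable P : probability Omega R.

Definition pr (E : set Omega) : R := fine (P E).

Lemma prE E : measurable E -> P E = (pr E)%:E.
Proof. by move=> mE; rewrite fineK ?fin_num_measure. Qed.

Lemma pr_ge0 E : 0 <= pr E.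
Proof. by rewrite fine_ge0. Qed.

Variables (U : choiceType) (X : Omega -> U).
Hypothesis mX : forall s, measurable [set w | X w = s].

Lemma measurable_in (L : seq U) : measurable [set w | X w \in L].
Proof.
elim: L => [|s L IH].
  by rewrite [X in measurable X](_ : _ = set0) //; apply/seteqP; split.
rewrite [X in measurable X](_ : _ = [set w | X w = s] `|` [set w | X w \in L]).
  exact: measurableU.
apply/seteqP; split => w /=; rewrite inE.
  by move=> /orP[/eqP|]; [left|right].
by case=> [->|->]; rewrite ?eqxx ?orbT.
Qed.

Lemma sum_pr_in (L : seq U) E : uniq L -> measurable E ->
  \sum_(s <- L) pr (E `&` [set w | X w = s]) = pr (E `&` [set w | X w \in L]).
Proof.
move=> + mE; elim: L => [_|s L IH /= /andP[sL uL]].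
  rewrite big_nil [X in pr X](_ : _ = set0) ?/pr ?measure0 //.
  by apply/seteqP; split => w // [].
have mI s' : measurable (E `&` [set w | X w = s']) by exact: measurableI.
have mL : measurable (E `&` [set w | X w \in L]).
  exact/measurableI/measurable_in.
apply: EFin_inj; rewrite big_cons EFinD IH // -!prE //; last first.
  exact/measurableI/measurable_in.
rewrite -measureU //.
  congr (P _); rewrite -setIUr; congr (_ `&` _).
  apply/seteqP; split => w /=; rewrite inE.
    by case=> [->|->]; rewrite ?eqxx ?orbT.
  by move=> /orP[/eqP|]; [left|right].
apply/seteqP; split => w //= [[_ /= ->] [_ /=]].
by rewrite (negPf sL).
Qed.

Lemma sum_pr (L : seq U) E : uniq L -> (forall w, X w \in L) -> measurable E ->
  \sum_(s <- L) pr (E `&` [set w | X w = s]) = pr E.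
Proof.
move=> uL XL mE; rewrite sum_pr_in //; congr pr.
by rewrite setIidl // => w _ /=.
Qed.

End FiniteValued.

(** * One turn of the process *)

Section Process.
Context {R : realType} {d : measure_display} {Omega : measurableType d}.
Variables (P : probability Omega R) (n m : nat) (f : option 'I_n -> R).
Variables (x : 'I_m -> nat) (A : nat -> Omega -> hands n m).
Hypothesis war : f_war P f x A.
Implicit Types (s : hands n m) (i : 'I_m) (t : nat).

Definition at_state t s : set Omega := [set w | A t w = s].
Definition segment k t (h : nat -> hands n m) : set Omega :=
  [set w | forall j, (k <= j <= t)%N -> A j w = h j].
Definition wins t i : set Omega := [set w | turn (A t w) i (A t.+1 w)].
Definition alive t : set Omega := [set w | ~ absorbing (A t w)].

Lemma measurable_at t s : measurable (at_state t s).
Proof. exact: (game_measurable war). Qed.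

Lemma in_states t w : A t w \in states n m.
Proof. exact/mem_states/(game_state war). Qed.

Lemma measurable_state_pred t (Q : hands n m -> Prop) :
  measurable [set w | Q (A t w)].
Proof.
rewrite [X in measurable X](_ : _ =
  [set w | A t w \in [seq s <- states n m | `[< Q s >]]]).
  by apply: measurable_in => s; exact: measurable_at.
apply/seteqP; split => w /=; rewrite mem_filter in_states andbT.
  by move=> ?; apply/asboolP.
by move/asboolP.
Qed.

Lemma measurable_segment k t h : measurable (segment k t h).
Proof.
rewrite [X in measurable X](_ : _ =
  \bigcap_(j in [set j | (k <= j <= t)%N]) at_state j (h j)).
  by apply: bigcap_measurableType => j _; exact: measurable_at.
by apply/seteqP; split => w /= H j; exact: H.
Qed.

Lemma measurable_wins t i : measurable (wins t i).
Proof.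
rewrite [X in measurable X](_ : _ =
  \big[setU/set0]_(s <- states n m)
     (at_state t s `&` [set w | turn s i (A t.+1 w)])).
  apply: bigsetU_measurable => s _; apply: measurableI; first exact: measurable_at.
  exact: (measurable_state_pred _ (fun B => turn s i B)).
rewrite -bigcup_seq; apply/seteqP; split => w /=.
  by exists (A t w) => //=; exact: in_states.
by case=> s _ [/= ats]; rewrite /wins /= (ats : A t w = s).
Qed.

(** The past before time [k] is forgotten by summing over the state at time
    [k - 1]; the step axiom is the case [k = 0] of a complete
    history. *)
Lemma segment_wins k t h i : (k <= t)%N -> ~ absorbing (h t) ->
  pr P (segment k t h `&` wins t i) =
  pr P (segment k t h) * win_prob f (h t) i.
Proof.
elim: k h => [|k IH] h kt nabs.
  have <- : history A t h = segment 0 t h.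
    by apply/seteqP; split => w /= H j; exact: H.
  by rewrite /pr (game_step war) // fineM ?fin_num_measure //;
    exact: (measurable_segment 0 t h).
have split_at E : measurable E -> pr P E =
    \sum_(s <- states n m) pr P (E `&` at_state k s).
  move=> mE; rewrite sum_pr ?states_uniq //; last exact: in_states.
  by move=> s; exact: measurable_at.
rewrite split_at; last first.
  by apply: measurableI; [exact: measurable_segment|exact: measurable_wins].
rewrite [in RHS]split_at; last exact: measurable_segment.
rewrite mulr_suml; apply: eq_bigr => s _.
pose h' j := if j == k then s else h j.
have segE : segment k.+1 t h `&` at_state k s = segment k t h'.
  apply/seteqP; split => w /=.
    move=> [H Aks] j /andP[kj jt]; rewrite /h'; case: eqVneq => [->//|jk].
    by apply: H; rewrite jt andbT ltn_neqAle eq_sym jk.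
  move=> H; split.
    move=> j /andP[kj jt]; rewrite H ?(ltnW kj) //.
    by rewrite /h' gtn_eqF.
  by rewrite /at_state /= H ?leqnn ?(ltnW kt) // /h' eqxx.
have h't : h' t = h t by rewrite /h' gtn_eqF.
by rewrite setIAC segE IH ?(ltnW kt) ?h't.
Qed.

Lemma at_wins t s i : ~ absorbing s ->
  pr P (at_state t s `&` wins t i) = pr P (at_state t s) * win_prob f s i.
Proof.
have -> : at_state t s = segment t t (fun=> s).
  apply/seteqP; split => w /=; last by apply; rewrite leqnn.
  by move=> Ats j; rewrite -eqn_leq => /eqP <-.
by move=> nabs; rewrite segment_wins.
Qed.

Definition step t s s' : R := pr P (at_state t s `&` at_state t.+1 s').

Lemma sum_step t s : \sum_(s' <- states n m) step t s s' = pr P (at_state t s).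
Proof.
rewrite sum_pr ?states_uniq //; last exact: measurable_at.
  by move=> s'; exact: measurable_at.
exact: in_states.
Qed.

Lemma sum_step_turn t s i : ~ absorbing s ->
  \sum_(s' <- states n m) `[< turn s i s' >]%:R * step t s s' =
  pr P (at_state t s) * win_prob f s i.
Proof.
move=> nabs; rewrite -at_wins // -(@sum_pr _ _ _ P _ (A t.+1) _ (states n m)).
- apply: eq_bigr => s' _; case: asboolP => ts; rewrite ?mul1r ?mul0r /step.
    congr pr; rewrite /at_state /wins; apply/seteqP; split => w /= [].
      by move=> -> ->.
    by move=> [-> _] ->.
  rewrite [X in pr _ X](_ : _ = set0) ?/pr ?measure0 //.
  apply/seteqP; split => w //= [[]]; rewrite /at_state /wins /=.
  by move=> -> + E; rewrite E.
- by move=> s'; exact: measurable_at.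
- exact: states_uniq.
- exact: in_states.
- by apply: measurableI; [exact: measurable_at|exact: measurable_wins].
Qed.

Lemma step_absorbing t s s' : absorbing s ->
  step t s s' = (s' == s)%:R * pr P (at_state t s).
Proof.
move=> abs; rewrite /step; case: eqVneq => [->|ss'].
  rewrite mul1r; congr pr; apply/setIidl => w Ats; rewrite /at_state /= in Ats *.
  by rewrite (game_absorbed war) Ats.
rewrite mul0r [X in pr _ X](_ : _ = set0) ?/pr ?measure0 //.
apply/seteqP; split => w //=; rewrite /at_state /= => -[Ats].
by rewrite (game_absorbed war) Ats // => E; rewrite E eqxx in ss'.
Qed.

Hypothesis fN : f None = 0.

Lemma turn_winner_uniq s i j s' : 0 < pot f s ->
  turn s i s' -> turn s j s' -> i = j.
Proof.
move=> F0 ti tj; apply/eqP; apply: contraT => ij.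
have := hand_weight_turn fN i ti; rewrite (hand_weight_turn fN i tj) eqxx.
by rewrite (negPf ij) mul0r mul1r => /addrI E; rewrite -E ltxx in F0.
Qed.

(** The events that [i] wins are disjoint and their conditional probabilities add
    up to 1, so a transition that no player's win explains has probability 0. *)
Lemma expected_step t s (g : hands n m -> R) (G : 'I_m -> R) :
  ~ absorbing s -> 0 < pot f s -> (forall i s', turn s i s' -> g s' = G i) ->
  \sum_(s' <- states n m) step t s s' * g s' =
  pr P (at_state t s) * \sum_(i < m) win_prob f s i * G i.
Proof.
move=> nabs F0 gG.
pose winners s' : R := \sum_(i < m) `[< turn s i s' >]%:R.
have winners_le1 s' : winners s' <= 1.
  rewrite /winners; have [[i ti]|none] := pselect (exists i, turn s i s').
    rewrite (bigD1 i) //= big1; first by rewrite addr0; case: asbool.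
    move=> j ji; case: asboolP => // tj.
    by rewrite (turn_winner_uniq F0 tj ti) eqxx in ji.
  rewrite big1 ?ler01 // => i _; case: asboolP => // ti.
  by case: none; exists i.
have stepE s' : s' \in states n m -> step t s s' = winners s' * step t s s'.
  have : \sum_(s' <- states n m) (1 - winners s') * step t s s' = 0.
    under eq_bigr do rewrite mulrBl mul1r /winners mulr_suml.
    rewrite sumrB sum_step exchange_big /=.
    under [X in _ - X]eq_bigr do rewrite sum_step_turn //.
    by rewrite -mulr_sumr sum_win_prob ?gt_eqF // mulr1 subrr.
  move=> /eqP; rewrite psumr_eq0; last first.
    by move=> s'' _; rewrite mulr_ge0 ?pr_ge0 // subr_ge0.
  move=> /allP H /H; rewrite mulrBl mul1r subr_eq0 => /eqP; exact.
under [LHS]eq_big_seq => s' /stepE -> do rewrite /winners 2!mulr_suml.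
rewrite exchange_big /= mulr_sumr; apply: eq_bigr => i _.
rewrite mulrA -sum_step_turn // mulr_suml; apply: eq_bigr => s' _.
by case: asboolP => [/gG->|]; rewrite ?mul0r.
Qed.

Definition mean t (g : hands n m -> R) : R :=
  \sum_(s <- states n m) pr P (at_state t s) * g s.

Lemma mean_step t g :
  mean t.+1 g =
  \sum_(s <- states n m) \sum_(s' <- states n m) step t s s' * g s'.
Proof.
rewrite exchange_big /=; apply: eq_bigr => s' _.
rewrite -mulr_suml; congr (_ * _).
rewrite -(@sum_pr _ _ _ P _ (A t) _ (states n m)).
- by apply: eq_bigr => s _; rewrite /step setIC.
- by move=> s; exact: measurable_at.
- exact: states_uniq.
- exact: in_states.
- exact: measurable_at.
Qed.

Lemma mean_potentialS t phi :
  (forall s, is_state s -> ~ absorbing s -> 0 < pot f s) ->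
  mean t.+1 (potential f phi) = mean t (potential f phi) +
    mean t (fun s => `[< ~ absorbing s >]%:R * drift f s phi).
Proof.
move=> F0; rewrite mean_step -big_split /=; apply: eq_big_seq => s /mem_states st.
rewrite -mulrDr; have [nabs|/contrapT abs] := asboolP (~ absorbing s).
  have potS := F0 s st nabs.
  rewrite mul1r -expected_potential ?gt_eqF //.
  by apply: expected_step => // i s'; exact: potential_turn.
rewrite mul0r addr0.
under eq_bigr do rewrite step_absorbing //.
have /mem_states sin := st.
rewrite (bigD1_seq s) ?states_uniq //= eqxx mul1r big1 ?addr0 // => s' ss'.
by rewrite (negPf ss') !mul0r.
Qed.

Lemma mean_cst t c : mean t (fun=> c) = c.
Proof.
rewrite /mean -mulr_suml.
under eq_bigr do rewrite -[at_state _ _]setTI.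
rewrite (@sum_pr _ _ _ P _ (A t) _ (states n m)) ?states_uniq //.
- by rewrite /pr probability_setT mul1r.
- by move=> s; exact: measurable_at.
- exact: in_states.
Qed.

Lemma mean_le t g g' : (forall s, is_state s -> pr P (at_state t s) != 0 ->
  g s <= g' s) -> mean t g <= mean t g'.
Proof.
move=> gg'; rewrite /mean big_seq [leRHS]big_seq.
apply: ler_sum => s /mem_states st.
have [->|p0] := eqVneq (pr P (at_state t s)) 0; first by rewrite !mul0r.
by rewrite ler_wpM2l ?pr_ge0 // gg'.
Qed.

Lemma mean_alive t : mean t (fun s => `[< ~ absorbing s >]%:R) = pr P (alive t).
Proof.
rewrite -(@sum_pr _ _ _ P _ (A t) _ (states n m)) ?states_uniq //.
- apply: eq_bigr => s _; case: asboolP => abs; rewrite ?mulr1 ?mulr0.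
    congr pr; apply/esym/setIidr => w /=.
    by rewrite /at_state /alive /= => ->.
  rewrite [X in pr _ X](_ : _ = set0) ?/pr ?measure0 //.
  apply/seteqP; split => w //=; rewrite /at_state /alive /=.
  by move=> -[+ E]; rewrite E.
- by move=> s; exact: measurable_at.
- exact: in_states.
- exact: (measurable_state_pred t (fun s => ~ absorbing s)).
Qed.

Lemma meanZ t k g : mean t (fun s => g s * k) = mean t g * k.
Proof. by rewrite /mean mulr_suml; apply: eq_bigr => s _; rewrite mulrA. Qed.

(** The [n!] distinct deals have probability [1 / n!] each, which leaves nothing
    for the other states. *)
Lemma start_deal s : (\sum_(i < m) x i)%N = n ->
  pr P (at_state 0 s) != 0 -> exists u, s = deal x u.
Proof.
move=> xn; apply: contraPP => nodeal; apply/negP; rewrite negbK.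
pose L := [seq deal x u | u <- enum {: 'S_n}].
have uL : uniq L by rewrite map_inj_uniq ?enum_uniq //; exact: deal_inj.
have sL : s \notin L.
  by apply/mapP => -[u _ su]; apply: nodeal; exists u.
have sumL : \sum_(s' <- L) pr P (setT `&` at_state 0 s') = 1.
  rewrite big_map big_enum /=.
  under eq_bigr do rewrite setTI /pr (game_start war) /=.
  by rewrite sumr_const card_Sn -[LHS]mulr_natr mulVf //
     pnatr_eq0 -lt0n fact_gt0.
have := @sum_pr_in _ _ _ P _ (A 0) (measurable_at 0) (s :: L) setT.
rewrite /= sL uL big_cons sumL setTI => /(_ isT measurableT) E.
have : pr P (setT `&` [set w | A 0%N w \in s :: L]) <= 1.
  have mL : measurable ([set: Omega] `&` [set w | A 0%N w \in s :: L]).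
    by apply: measurableI => //; apply: measurable_in; exact: measurable_at.
  by rewrite -lee_fin -prE // probability_le1.
by rewrite -E gerDr => p0; apply/eqP/le_anti; rewrite p0 pr_ge0.
Qed.

End Process.

(** * The length of the game as a series *)

Section Length.
Context {R : realType} {d : measure_display} {Omega : measurableType d}.
Variables (P : probability Omega R) (n m : nat) (f : option 'I_n -> R).
Variables (x : 'I_m -> nat) (A : nat -> Omega -> hands n m).
Hypothesis war : f_war P f x A.

Lemma absorbing_stays s t w : absorbing (A s w) -> (s <= t)%N ->
  absorbing (A t w).
Proof.
move=> abs /subnK <-; elim: (t - s)%N => // k IH.
by rewrite addSn (game_absorbed war).
Qed.

Lemma sum_alive_le N s w : absorbing (A s w) ->
  \sum_(0 <= t < N) (\1_(alive A t) w : R) <= (minn N s)%:R.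
Proof.
move=> abs; elim: N => [|N IH]; first by rewrite big_geq.
rewrite big_nat_recr //=; have [Ns|sN] := ltnP N s.
  rewrite (minn_idPl Ns) -natr1; apply: lerD.
    by rewrite (minn_idPl (ltnW Ns)) in IH.
  by rewrite indicE; case: (_ \in _).
rewrite indicE memNset ?addr0; last by apply; exact: (absorbing_stays abs sN).
by rewrite (minn_idPr sN) in IH; rewrite (minn_idPr (leqW sN)).
Qed.

Lemma game_length_series w :
  game_length (R := R) A w = (\sum_(t <oo) (\1_(alive A t) w)%:E)%E.
Proof.
have nn t : (0 <= (\1_(alive A t) w : R)%:E)%E by rewrite lee_fin.
have sum_ge N : (forall t, (t < N)%N -> ~ absorbing (A t w)) ->
    ((N%:R : R)%:E <= \sum_(t <oo) (\1_(alive A t) w)%:E)%E.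
  move=> nabs; apply: le_trans (nneseries_lim_ge N _); last by move=> *; exact: nn.
  rewrite sumEFin lee_fin (eq_big_nat _ _ (F2 := fun=> 1)); last first.
    by move=> t /= tN; rewrite indicE mem_set //; exact: nabs.
  by rewrite sumr_const_nat subn0.
apply/le_anti/andP; split; last first.
  apply: le_ereal_inf_tmp => _ [s abs <-]; apply: lime_le.
    by apply: is_cvg_nneseries => *; exact: nn.
  apply: nearW => N; rewrite sumEFin lee_fin.
  by apply: le_trans (sum_alive_le N abs) _; rewrite ler_nat geq_minr.
have [ends|never] := pselect (exists t, `[< absorbing (A t w) >]).
  case: (ex_minnP ends) => T /asboolP absT minT.
  apply: le_trans (sum_ge T _); first by apply: ereal_inf_lbound; exists T.
  by move=> t tT /asboolP /minT; rewrite leqNgt tT.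
suff -> : (\sum_(t <oo) (\1_(alive A t) w : R)%:E = +oo)%E by rewrite leey.
apply/eqyP => r r0; apply: le_trans (sum_ge (Num.trunc r).+1 _).
  by rewrite lee_fin ltW // truncnS_gt.
by move=> t _ abs; apply: never; exists t; apply/asboolP.
Qed.

Lemma expected_length_series :
  expected_length P A = (\sum_(t <oo) (pr P (alive A t))%:E)%E.
Proof.
rewrite /expected_length.
under eq_integral do rewrite game_length_series.
have mal t : measurable (alive A t).
  exact: (measurable_state_pred war t (fun s => ~ absorbing s)).
rewrite integral_nneseries //.
- apply: eq_eseriesr => t _.
  by rewrite integral_indic // setIT; exact: prE.
- by move=> t; apply/measurable_EFinP/measurable_indic.
Qed.

End Length.

(** * Bounds on the number of turns *)

Section Bounds.
Context {R : realType} {d : measure_display} {Omega : measurableType d}.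
Variables (P : probability Omega R) (n m : nat) (f : option 'I_n -> R) (C : R).
Variables (x : 'I_m -> nat) (A : nat -> Omega -> hands n m).
Hypothesis war : f_war P f x A.
Hypothesis fN : f None = 0.
Hypothesis f_ge1 : forall k, 1 <= f (Some k).
Hypothesis f_leC : forall k, f (Some k) <= C.
Hypothesis C1 : 1 <= C.
Hypothesis m0 : (0 < m)%N.

Local Notation mean := (mean P A).
Local Notation p t := (pr P (alive A t)).
Local Notation T := (total f).
Local Notation sqr := (fun y : R => y ^+ 2).

Lemma mean_potential_recr t phi : mean t.+1 (potential f phi) =
  mean t (potential f phi) +
  mean t (fun s => `[< ~ absorbing s >]%:R * drift f s phi).
Proof.
rewrite (mean_potentialS war fN) // => s st nabs.
exact: (pot_gt0 fN f_ge1 st m0 nabs).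
Qed.

Lemma mean_potential_ge phi k N :
  (forall s : hands n m, is_state s -> ~ absorbing s -> k <= drift f s phi) ->
  mean 0 (potential f phi) + (\sum_(0 <= t < N) p t) * k <=
  mean N (potential f phi).
Proof.
move=> kd; elim: N => [|N IH]; first by rewrite big_geq // mul0r addr0.
rewrite mean_potential_recr big_nat_recr //= mulrDl addrA lerD //.
rewrite -(mean_alive war) -meanZ; apply: mean_le => s st _.
by case: asboolP => nabs; rewrite ?mul0r // !mul1r kd.
Qed.

Lemma mean_potential_le phi k N :
  (forall s : hands n m, is_state s -> ~ absorbing s -> drift f s phi <= k) ->
  mean N (potential f phi) <=
  mean 0 (potential f phi) + (\sum_(0 <= t < N) p t) * k.
Proof.
move=> kd; elim: N => [|N IH]; first by rewrite big_geq // mul0r addr0.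
rewrite mean_potential_recr big_nat_recr //= mulrDl addrA lerD //.
rewrite -(mean_alive war) -meanZ; apply: mean_le => s st _.
by case: asboolP => nabs; rewrite ?mul0r // !mul1r kd.
Qed.

Lemma total_sqr_le : T ^+ 2 <= (C * n%:R) ^+ 2.
Proof.
rewrite ler_pXn2r ?nnegrE ?(total_le f_leC) ?(total_ge0 f_ge1) //.
by rewrite mulr_ge0 // (le_trans ler01).
Qed.

Lemma sum_alive_le_sqr N : 2 * \sum_(0 <= t < N) p t <= (C * n%:R) ^+ 2.
Proof.
apply: le_trans total_sqr_le.
have := @mean_potential_ge sqr 2 N
  (fun s st nabs => drift_sqr_ge fN f_ge1 st m0 nabs).
have : 0 <= mean 0 (potential f sqr).
  rewrite -(mean_cst war 0 0); apply: mean_le => s _ _.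
  by apply: sumr_ge0 => j _; exact: sqr_ge0.
have : mean N (potential f sqr) <= T ^+ 2.
  rewrite -[leRHS](mean_cst war N); apply: mean_le => s st _.
  exact: sum_sqr_weight_le.
lra.
Qed.

(** Otherwise the sum of the [p t] would grow linearly. *)
Lemma exists_alive_small delta : 0 < delta -> exists N, p N <= delta.
Proof.
move=> d0; apply: contrapT => none.
have big t : delta < p t.
  by rewrite ltNge; apply/negP => pt; apply: none; exists t.
pose N := (Num.trunc ((C * n%:R) ^+ 2 / delta)).+1.
have := sum_alive_le_sqr N.
have : N%:R * delta <= \sum_(0 <= t < N) p t.
  rewrite mulr_natl -[N in leLHS]subn0 -sumr_const_nat; apply: ler_sum => t _.
  exact: ltW.
have : (C * n%:R) ^+ 2 < N%:R * delta by rewrite -ltr_pdivrMr // truncnS_gt.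
have := sqr_ge0 (C * n%:R); lra.
Qed.

Variable alpha : R.
Hypothesis x_sum : (\sum_(i < m) x i)%N = n.
Hypothesis x_le : forall i, (x i)%:R <= alpha * n%:R.

(** The potential of [psi] is at most [T ^+ 2 - (1 - alpha) * n ^+ 2] at the start
    and at least [T ^+ 2 - 8 * C ^+ 2 * (h * T)] once the game is over; while the
    game goes on it may miss the square [T ^+ 2], which costs [T ^+ 2 * p N]. *)
Lemma sum_alive_ge N h K :
  0 < h -> C * m%:R <= h / 2 -> 4 * T <= K * h ->
  (1 - alpha) * n%:R ^+ 2 - T ^+ 2 * p N - 8 * C ^+ 2 * (h * T) <=
  (C * K) ^+ 2 * \sum_(0 <= t < N) p t.
Proof.
move=> h0 mh TK; pose psi y := y ^+ 2 - (8 * C ^+ 2) * huber h y.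
have B0 : 0 <= 8 * C ^+ 2 by rewrite mulr_ge0 ?sqr_ge0.
have psiE s : potential f psi s =
    potential f sqr s - 8 * C ^+ 2 * potential f (huber h) s.
  by rewrite /potential mulr_sumr -sumrB.
have start : mean 0 (potential f psi) <= T ^+ 2 - (1 - alpha) * n%:R ^+ 2.
  rewrite -[leRHS](mean_cst war 0); apply: mean_le => s st ps.
  have [u su] := start_deal war x_sum ps.
  have bal j : (size (s j))%:R <= alpha * n%:R by rewrite su size_deal.
  apply: le_trans (sum_sqr_weight_balanced f_ge1 st bal).
  rewrite psiE gerBl mulr_ge0 //; apply: sumr_ge0 => j _.
  by apply: huber_ge0; exact: ltW.
have finish : T ^+ 2 - T ^+ 2 * p N - 8 * C ^+ 2 * (h * T) <=
    mean N (potential f psi).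
  have -> : T ^+ 2 - T ^+ 2 * p N - 8 * C ^+ 2 * (h * T) =
     T ^+ 2 - 8 * C ^+ 2 * (h * T) - p N * T ^+ 2 by ring.
  rewrite lerBlDr -(mean_alive war) -meanZ -[leLHS](mean_cst war N).
  rewrite /(mean N _) -big_split /=.
  under [leRHS]eq_bigr do rewrite -mulrDr.
  apply: mean_le => s st _; rewrite psiE.
  have hub : potential f (huber h) s <= h * T.
    rewrite -(sum_weight f st) mulr_sumr; apply: ler_sum => j _.
    by apply: huber_le; exact: weight_ge0.
  have := ler_wpM2l B0 hub.
  have sq0 : 0 <= potential f sqr s.
    by apply: sumr_ge0 => j _; exact: sqr_ge0.
  case: asboolP => [nabs|/contrapT abs] /=; first lra.
  have := sum_sqr_weight_absorbing f st abs; rewrite -/(potential f sqr s); lra.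
have := @mean_potential_le psi ((C * K) ^+ 2) N
  (fun s st nabs => drift_mixed_le fN f_ge1 f_leC st m0 nabs C1 mh h0 TK).
lra.
Qed.

End Bounds.

(** * The two bounds *)

Lemma f_war_scale {R : realType} {d : measure_display} {Omega : measurableType d}
    (P : probability Omega R) (n m : nat) (f : option 'I_n -> R)
    (x : 'I_m -> nat) (A : nat -> Omega -> hands n m) (mu : R) :
  mu != 0 -> f_war P f x A -> f_war P (fun o => f o / mu) x A.
Proof.
move=> mu0 [? ? ? stepA ?]; split => // t h i nabs; rewrite stepA //.
congr (_ * _%:E)%E; rewrite /win_prob -mulr_suml invfM invrK mulrACA mulVf //.
by rewrite mulr1.
Qed.

Section MainBounds.
Context {R : realType} {d : measure_display} {Omega : measurableType d}.
Variables (P : probability Omega R) (n m : nat) (f : option 'I_n -> R) (C : R).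
Variables (x : 'I_m -> nat) (A : nat -> Omega -> hands n m) (alpha : R).
Hypothesis war : f_war P f x A.
Hypothesis fN : f None = 0.
Hypothesis f_ge1 : forall k, 1 <= f (Some k).
Hypothesis f_leC : forall k, f (Some k) <= C.
Hypothesis C1 : 1 <= C.
Hypothesis m0 : (0 < m)%N.

Lemma expected_length_le :
  (expected_length P A <= (C ^+ 2 / 2 * n%:R ^+ 2)%:E)%E.
Proof.
rewrite (expected_length_series war); apply: lime_le.
  by apply: is_cvg_nneseries => t _ _; rewrite lee_fin pr_ge0.
apply: nearW => N; rewrite sumEFin lee_fin.
have := sum_alive_le_sqr war fN f_ge1 f_leC C1 m0 N; rewrite exprMn; lra.
Qed.

Hypothesis x_sum : (\sum_(i < m) x i)%N = n.
Hypothesis x_le : forall i, (x i)%:R <= alpha * n%:R.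
Hypothesis n0 : (0 < n)%N.
Hypothesis alpha1 : alpha < 1.

(* [h = eta * n] is chosen so that [8 * C ^+ 2 * (h * T)] is at most half of the
   growth [(1 - alpha) * n ^+ 2], and [K] so that [4 * T <= K * h]. *)
Let eta : R := (1 - alpha) / (16 * C ^+ 3).
Let K : R := 4 * C / eta.

Lemma expected_length_ge : C * m%:R <= eta * n%:R / 2 ->
  (((1 - alpha) / (4 * (C * K) ^+ 2) * n%:R ^+ 2)%:E <= expected_length P A)%E.
Proof.
move=> few; have C0 : 0 < C by apply: lt_le_trans C1.
have a1 : 0 < 1 - alpha by rewrite subr_gt0.
have eta0 : 0 < eta by rewrite divr_gt0 // mulr_gt0 // exprn_gt0.
have K0 : 0 < K by rewrite divr_gt0 // mulr_gt0.
have nR : 0 < n%:R :> R by rewrite ltr0n.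
have [|N pN] := @exists_alive_small _ _ _ P n m f C x A war fN f_ge1 f_leC C1 m0
  ((1 - alpha) / (4 * C ^+ 2)); first by rewrite divr_gt0 // mulr_gt0 ?exprn_gt0.
have T_le := total_le f_leC; have T0 := total_ge0 f_ge1.
have TK : 4 * total f <= K * (eta * n%:R).
  have -> : K * (eta * n%:R) = 4 * (C * n%:R) by rewrite /K; field; rewrite gt_eqF.
  by rewrite ler_wpM2l.
have key := sum_alive_ge war fN f_ge1 f_leC C1 m0 x_sum x_le N
  (mulr_gt0 eta0 nR) few TK.
have loss1 : total f ^+ 2 * pr P (alive A N) <= (1 - alpha) / 4 * n%:R ^+ 2.
  have -> : (1 - alpha) / 4 * n%:R ^+ 2 =
      (C * n%:R) ^+ 2 * ((1 - alpha) / (4 * C ^+ 2)).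
    by field; rewrite gt_eqF.
  by apply: ler_pM; rewrite ?sqr_ge0 ?pr_ge0 ?(total_sqr_le f_ge1 f_leC C1).
have loss2 : 8 * C ^+ 2 * (eta * n%:R * total f) <= (1 - alpha) / 2 * n%:R ^+ 2.
  have -> : (1 - alpha) / 2 * n%:R ^+ 2 =
      8 * C ^+ 2 * (eta * n%:R * (C * n%:R)).
    by rewrite /eta; field; rewrite gt_eqF.
  apply: ler_wpM2l; first by rewrite mulr_ge0 ?sqr_ge0.
  by apply: ler_wpM2l => //; rewrite mulr_ge0 // ltW.
rewrite (expected_length_series war).
apply: le_trans (nneseries_lim_ge N _); last first.
  by move=> t _ _; rewrite lee_fin pr_ge0.
rewrite sumEFin lee_fin.
have CK0 : 0 < (C * K) ^+ 2 by rewrite exprn_gt0 // mulr_gt0.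
rewrite -(ler_pM2l CK0); apply: le_trans key.
have -> : (C * K) ^+ 2 * ((1 - alpha) / (4 * (C * K) ^+ 2) * n%:R ^+ 2) =
    (1 - alpha) / 4 * n%:R ^+ 2 by field; rewrite !gt_eqF.
lra.
Qed.

End MainBounds.

Theorem corollary2p10 (R : realType) (alpha c : R) (p_minus p_plus : nat -> R)
    (halpha : alpha < 1) (hc : 1 <= c)
    (hp_minus : Omega_inv p_minus)
    (hp_plus : p_plus =O_\oo (fun r : nat => (r%:R : R)^-1)) :
  exists beta c1 c2 : R, [/\ 0 < beta, 0 < c1, 0 < c2 &
    forall (n m : nat), (0 < n)%N -> (2 <= m)%N -> beta < n%:R / m%:R ->
    forall f : option 'I_n -> R,
      f None = 0 ->
      (forall k : 'I_n, 0 < f (Some k)) ->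
      (forall i j : 'I_n, f (Some i) <= c * f (Some j)) ->
      (forall (S : {set 'I_n}) (a : 'I_n), a \in S ->
         p_minus #|S| <= f (Some a) / \sum_(k in S) f (Some k) /\
         f (Some a) / \sum_(k in S) f (Some k) <= p_plus #|S|) ->
    forall x : 'I_m -> nat,
      (\sum_(i < m) x i)%N = n ->
      (forall i : 'I_m, (x i)%:R <= alpha * n%:R) ->
    forall (d : measure_display) (Omega : measurableType d)
      (P : probability Omega R) (A : nat -> Omega -> hands n m),
      f_war P f x A ->
      ((c1 * n%:R ^+ 2)%:E <= expected_length P A)%E /\
      (expected_length P A <= (c2 * n%:R ^+ 2)%:E)%E].
Proof.
have c0 : 0 < c by apply: lt_le_trans hc.
have a1 : 0 < 1 - alpha by rewrite subr_gt0.
pose eta := (1 - alpha) / (16 * c ^+ 3).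
have eta0 : 0 < eta by rewrite divr_gt0 // mulr_gt0 // exprn_gt0.
pose K := 4 * c / eta.
have K0 : 0 < K by rewrite divr_gt0 // mulr_gt0.
(* [2 * c / eta] is the value of [n / m] above which [c * m], a bound on the pot,
   is at most [h / 2] for [h = eta * n] *)
exists (2 * c / eta), ((1 - alpha) / (4 * (c * K) ^+ 2)), (c ^+ 2 / 2); split.
- by rewrite divr_gt0 // mulr_gt0.
- by rewrite divr_gt0 // mulr_gt0 // exprn_gt0 // mulr_gt0.
- by rewrite divr_gt0 // exprn_gt0.
move=> n m n0 m2 beta_lt f fN f_gt0 f_ratio _ x x_sum x_le d Omega P A war.
have m0 : (0 < m)%N by apply: leq_trans m2.
(* the odds of winning are unchanged when [f] is divided by its minimum *)
pose k0 := [arg min_(k < Ordinal n0) f (Some k)]%O.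
have k0_min k : f (Some k0) <= f (Some k).
  by rewrite /k0; case: arg_minP => // i _ /(_ k isT).
have mu0 := f_gt0 k0.
have war' := f_war_scale (negbT (gt_eqF mu0)) war.
have gN : f None / f (Some k0) = 0 by rewrite fN mul0r.
have g_ge1 k : 1 <= f (Some k) / f (Some k0) by rewrite ler_pdivlMr // mul1r.
have g_lec k : f (Some k) / f (Some k0) <= c by rewrite ler_pdivrMr.
split; last exact: (expected_length_le war' gN g_ge1 g_lec).
apply: (expected_length_ge war' gN g_ge1 g_lec) => //.
have mR : 0 < m%:R :> R by rewrite ltr0n.
move: beta_lt; rewrite ltr_pdivlMr // => beta_lt.
have := ler_wpM2l (ltW eta0) (ltW beta_lt).
have -> : eta * (2 * c / eta * m%:R) = 2 * (c * m%:R).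
  by field; rewrite gt_eqF.
rewrite -/eta; lra.
Qed.
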